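(* Let $R$ be a decomposable commutative ring with identity, $S\subseteq R$ a multiplicative set, and $J$ an ideal of $R$ such that $eJ\neq (e)$ for each $e\in \mathrm{Idem}(R)\setminus\{0,1\}$. Then $R$ is $S$-$J$-Noetherian if and only if $R$ is $S$-Noetherian.
   Context: A multiplicative set $S\subseteq R$ is a subset containing $1$ and closed under multiplication. $\mathrm{Idem}(R)$ denotes the set of idempotent elements of $R$. The ring $R$ is decomposable if it admits a non-trivial idempotent, i.e. an idempotent different from $0$ and $1$. An ideal $I$ of $R$ is called $S$-finite if there exist $s\in S$ and a finitely generated ideal $F$ of $R$ such that $sI\subseteq F\subseteq I$. The ring $R$ is $S$-Noetherian if every ideal of $R$ is $S$-finite. An ideal $I$ of $R$ is called a $J$-ideal if $I\nsubseteq J$. The ring $R$ is called $S$-$J$-Noetherian if every $J$-ideal of $R$ is $S$-finite. *)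

(* Defs.v *)
From mathcomp Require Import all_boot all_algebra.
From mathcomp Require Import boolp classical_sets.

Set Implicit Arguments.
Unset Strict Implicit.
Unset Printing Implicit Defensive.

Import GRing.Theory.
Local Open Scope classical_set_scope.
Local Open Scope ring_scope.

Section Ideals.
Variable R : comPzRingType.
Implicit Types I J F S : set R.

(* An ideal is a submodule of R over itself; unlike idealr in ring_quotient,
   the whole ring is allowed. *)
Definition is_ideal I : Prop := GRing.submod_closed ([in I] : {pred R^o}).

Definition multiplicative_set S : Prop := GRing.mulr_closed [in S].

Definition ideal_gen (A : set R) : set R := smallest is_ideal A.

Definition finitely_generated F : Prop :=
  exists s : seq R, F = ideal_gen [set` s].

Definition scale_set (a : R) (A : set R) : set R := [set a * x | x in A].

Definition S_finite S I : Prop :=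
  exists (s : R) (F : set R),
    [/\ S s, finitely_generated F, scale_set s I `<=` F & F `<=` I].

Definition S_Noetherian S : Prop :=
  forall I, is_ideal I -> S_finite S I.

Definition J_ideal J I : Prop := is_ideal I /\ ~ (I `<=` J).

Definition S_J_Noetherian S J : Prop :=
  forall I, J_ideal J I -> S_finite S I.

End Ideals.

Definition Idem (R : comPzRingType) : set R := [set e | e * e = e].

Definition decomposable (R : comPzRingType) : Prop :=
  exists e : R, (@Idem R `\` [set 0; 1]) e.

(* Main.v *)
Require Import Defs.
From mathcomp Require Import all_boot all_algebra.
From mathcomp Require Import boolp classical_sets.

Import GRing.Theory.
Local Open Scope classical_set_scope.
Local Open Scope ring_scope.

(** For an ideal [I] and an element [a], the colon ideal
    [(I : a) = {x | a * x is in I}] contains [I], and it contains every element that [a] annihilates.  Let [e] be a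
    non-trivial idempotent and [f = 1 - e], which is another one.  The
    hypothesis on [J] says exactly that no non-trivial idempotent lies in [J]:
    if [e] were in [J], then [eJ] would contain [e = e * e], hence all of
    [(e)] ([idem_scale_ideal]).  Since [e * f = 0], the ideal [(I : e)] contains [f] and
    [(I : f)] contains [e], so both are [J]-ideals, however small [I] is
    ([J_ideal_colon]).

    It remains to recover [I] from the two colon ideals ([S_finite_colon]).
    If [s1 (I : e)] lies in a finitely generated [F1] inside [(I : e)], and [s2],
    [F2] are the analogous data for [f], then every [x] in [I] satisfies
    [s1 s2 x = s2 (e (s1 x)) + s1 (f (s2 x))], which lies in [e F1 + f F2];
    that ideal is finitely generated and contained in [I]. *)

Lemma is_idealP (R : comPzRingType) (I : set R) :
  is_ideal I <-> I 0 /\ (forall r x y, I x -> I y -> I (r * x + y)).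
Proof.
split=> [[I0 Il]|[I0 Il]].
  split=> [|r x y Ix Iy]; first exact: set_mem.
  by apply: set_mem; apply: (Il r x y); apply: mem_set.
split=> [|r x y /set_mem Ix /set_mem Iy]; apply: mem_set => //.
exact: Il.
Qed.

Lemma idealD (R : comPzRingType) (I : set R) x y :
  is_ideal I -> I x -> I y -> I (x + y).
Proof. by move=> /is_idealP[_ Il] Ix Iy; rewrite -[x]mul1r; apply: Il. Qed.

Lemma idealMl (R : comPzRingType) (I : set R) r x :
  is_ideal I -> I x -> I (r * x).
Proof.
by move=> /is_idealP[I0 Il] Ix; rewrite -[_ * _]addr0; apply: Il.
Qed.

Lemma ideal_gen_ideal (R : comPzRingType) (A : set R) : is_ideal (ideal_gen A).
Proof.
apply/is_idealP; split=> [B [/is_idealP[B0 _] _] //|r x y Ax Ay B AB].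
have [/is_idealP[_ Bl] _] := AB.
by apply: Bl; [apply: Ax|apply: Ay].
Qed.

Definition colon {R : comPzRingType} (I : set R) (a : R) : set R :=
  [set x | I (a * x)].

Lemma colon_ideal (R : comPzRingType) (I : set R) a :
  is_ideal I -> is_ideal (colon I a).
Proof.
move=> /is_idealP[I0 Il]; apply/is_idealP; split=> [|r x y Ix Iy].
  by rewrite /colon /= mulr0.
by rewrite /colon /= mulrDr mulrCA; apply: Il.
Qed.

(** Multiplication by [a] carries the ideal of [A] into that of [B] as soon as it
    does so on generators; the colon ideal turns this into the minimality of
    [ideal_gen A]. *)
Lemma ideal_gen_sub_colon (R : comPzRingType) (A B : set R) a :
  (forall x, A x -> B (a * x)) -> ideal_gen A `<=` colon (ideal_gen B) a.
Proof.
move=> AB; apply: smallest_sub; first exact/colon_ideal/ideal_gen_ideal.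
by move=> x /AB; apply: sub_gen_smallest.
Qed.

(** An [x] in [I] lies in both colon ideals, and [x = a x + b x] puts a multiple
    of it in [a F1 + b F2], where [F1] and [F2] are finitely generated ideals
    witnessing the two hypotheses. *)
Lemma S_finite_colon (R : comPzRingType) (S I : set R) a b :
  multiplicative_set S -> is_ideal I -> a + b = 1 ->
  S_finite S (colon I a) -> S_finite S (colon I b) -> S_finite S I.
Proof.
move=> [_ SM] idI ab1 [s1 [_ [Ss1 [g1 ->] sF1 F1I]]].
move=> [s2 [_ [Ss2 [g2 ->] sF2 F2I]]].
pose g := map ( *%R a) g1 ++ map ( *%R b) g2.
exists (s1 * s2), (ideal_gen [set` g]); split.
- by apply: set_mem; apply: SM; apply: mem_set.
- by exists g.
- move=> _ [x Ix <-].
  have F1 : ideal_gen [set` g1] (s1 * x).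
    by apply: sF1; exists x => //; apply: idealMl.
  have F2 : ideal_gen [set` g2] (s2 * x).
    by apply: sF2; exists x => //; apply: idealMl.
  have -> : s1 * s2 * x = s2 * (a * (s1 * x)) + s1 * (b * (s2 * x)).
    rewrite -[LHS]mul1r -ab1 mulrDl; congr (_ + _).
      by rewrite (mulrC s1) -mulrA mulrCA.
    by rewrite -mulrA mulrCA.
  have idg := ideal_gen_ideal R [set` g].
  have sub1 : ideal_gen [set` g1] `<=` colon (ideal_gen [set` g]) a.
    by apply: ideal_gen_sub_colon => y /= yg; rewrite mem_cat map_f.
  have sub2 : ideal_gen [set` g2] `<=` colon (ideal_gen [set` g]) b.
    by apply: ideal_gen_sub_colon => y /= yg; rewrite mem_cat map_f ?orbT.
  apply: (idealD _ _ _ _ idg).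
    exact: (idealMl _ _ s2 _ idg (sub1 _ F1)).
  exact: (idealMl _ _ s1 _ idg (sub2 _ F2)).
- apply: smallest_sub => // y /=; rewrite mem_cat.
  case/orP=> /mapP[z zg ->]; [apply: F1I|apply: F2I];
    exact: sub_gen_smallest.
Qed.

Lemma idem_compl (R : comPzRingType) (e : R) :
  (@Idem R `\` [set 0; 1]) e -> (@Idem R `\` [set 0; 1]) (1 - e).
Proof.
move=> [ee ne]; split.
  by rewrite /Idem /= mulrBl mul1r mulrBr mulr1 ee subrr subr0.
move=> [/= h|/= h]; apply: ne; [right|left] => /=.
  by apply/esym/eqP; rewrite -subr_eq0 h.
by rewrite -[e](subKr 1) h subrr.
Qed.

(** The set [eJ] is itself an ideal, and it contains [e = e * e]. *)
Lemma idem_scale_ideal (R : comPzRingType) (J : set R) (e : R) :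
  is_ideal J -> Idem e -> J e -> scale_set e J = ideal_gen [set e].
Proof.
move=> idJ ee Je; apply/seteqP; split=> [_ [x _ <-]|].
  have Ge : ideal_gen [set e] e by exact: sub_gen_smallest.
  by rewrite mulrC; exact: (idealMl _ _ x _ (ideal_gen_ideal _ _) Ge).
apply: smallest_sub; last by move=> _ ->; exists e.
apply/is_idealP; split=> [|r _ _ [x Jx <-] [y Jy <-]].
  by exists 0; rewrite ?mulr0 //; have /is_idealP[] := idJ.
exists (r * x + y); last by rewrite mulrDr mulrCA.
by apply: idealD => //; apply: idealMl.
Qed.

(** The source of [J]-ideals: the annihilated element [b] lies in [(I : a)]
    whatever [I] is, even for [I = 0]. *)
Lemma J_ideal_colon (R : comPzRingType) (I J : set R) a b :
  is_ideal I -> a * b = 0 -> ~ J b -> J_ideal J (colon I a).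
Proof.
move=> idI ab0 nJb; split; first exact: colon_ideal.
by move=> /(_ b) sub; apply/nJb/sub; rewrite /colon /= ab0; case/is_idealP: idI.
Qed.

Theorem theorem2p18 (R : comPzRingType) (S J : set R) :
  decomposable R ->
  multiplicative_set S ->
  is_ideal J ->
  (forall e : R, (@Idem R `\` [set 0; 1]) e ->
     scale_set e J <> ideal_gen [set e]) ->
  S_J_Noetherian S J <-> S_Noetherian S.
Proof.
move=> [e ide] Smul idJ hJ; split=> [SJ I idI|SN I [idI _]]; last exact: SN.
have notJ e' : (@Idem R `\` [set 0; 1]) e' -> ~ J e'.
  by move=> ide' Je'; apply: (hJ _ ide'); apply: idem_scale_ideal => //; case: ide'.
have ef0 : e * (1 - e) = 0 by case: ide => ee _; rewrite mulrBr mulr1 ee subrr.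
apply: (@S_finite_colon _ S I e (1 - e)) => //.
- by rewrite addrC subrK.
- by apply: SJ; apply: J_ideal_colon ef0 _ => //; apply/notJ/idem_compl.
- by apply: SJ; apply: (@J_ideal_colon _ I J _ e) => //;
    [rewrite mulrC|apply: notJ].
Qed.
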